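(* Let $\mathbf{R}_1,\dots,\mathbf{R}_K\in\mathbb{C}^{M\times M}$ be nonzero Hermitian positive semidefinite matrices, let $\tau_p,\varrho_k,\sigma^2,\zeta_m,b_{\mathrm{tot}},\epsilon_{\max},\rho_{\max}>0$ be constants, and let $\boldsymbol{\Psi}_1,\dots,\boldsymbol{\Psi}_K\in\mathbb{C}^{M\times M}$ be fixed Hermitian positive definite matrices (not depending on the optimization variables). With $\overline{\mathrm{SINR}}_k(\boldsymbol\epsilon,\boldsymbol\rho)$ as defined in the context, consider the two optimization problems over $\boldsymbol\epsilon=(\epsilon_1,\dots,\epsilon_M)$ and $\boldsymbol\rho=(\rho_1,\dots,\rho_K)$ $$\begin{aligned}\text{maximize}\quad & f^{\mathrm{obj}}(\boldsymbol\epsilon,\boldsymbol\rho)\\ \text{subject to}\quad & \sum_{m=1}^{M}\log_2\Big(\frac{\zeta_m}{\epsilon_m}\Big)-b_{\mathrm{tot}}\le 0,\\ & 0\le\epsilon_m\le\epsilon_{\max}\ \forall m,\qquad 0\le\rho_k\le\rho_{\max}\ \forall k,\end{aligned}$$ with either $f^{\mathrm{obj}}=\prod_{k=1}^{K}\overline{\mathrm{SINR}}_k(\boldsymbol\epsilon,\boldsymbol\rho)$ (max-product of SINRs) or $f^{\mathrm{obj}}=\min_{k\in\{1,\dots,K\}}\overline{\mathrm{SINR}}_k(\boldsymbol\epsilon,\boldsymbol\rho)$ (max-min fairness). Under the change of variables $x_m=\epsilon_m^2$, $\mathbf{x}=(x_1,\dots,x_M)^T$, these problems can be cast, respectively, as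 the following geometric programming problems in positive variables $t$, $x_1,\dots,x_M$, $\rho_1,\dots,\rho_K$ (equivalent in the sense of having the same optimal value, with optimal $(\boldsymbol\epsilon,\boldsymbol\rho)$ corresponding to optimal $(\mathbf{x},\boldsymbol\rho)$ through $x_m=\epsilon_m^2$). Max-product of SINRs: $$\begin{aligned}\text{maximize}\quad & t\prod_{k=1}^{K}\rho_kw_k\\ \text{subject to}\quad & t\prod_{k=1}^{K}f_k^{\mathrm{d}}(\mathbf{x},\boldsymbol\rho)\le1,\qquad \prod_{m=1}^{M}\zeta_m^2x_m^{-1}\le2^{2b_{\mathrm{tot}}},\\ & x_m\le\epsilon_{\max}^2\ \forall m,\qquad \rho_k\le\rho_{\max}\ \forall k.\end{aligned}$$ Max-min fairness: $$\begin{aligned}\text{maximize}\quad & t\\ \text{subject to}\quad & \frac{t\,f_k^{\mathrm{d}}(\mathbf{x},\boldsymbol\rho)}{\rho_kw_k}\le1\ \forall k,\qquad \prod_{m=1}^{M}\zeta_m^2x_m^{-1}\le2^{2b_{\mathrm{tot}}},\\ & x_m\le\epsilon_{\max}^2\ \forall m,\qquad \rho_k\le\rho_{\max}\ \forall k.\end{aligned}$$ Here $\mathbf{A}_k=\mathbf{R}_k\boldsymbol{\Psi}_k^{-1}\mathbf{R}_k$, $w_k=(\mathrm{tr}(\mathbf{A}_k))^2$, and $$\begin{aligned}f_k^{\mathrm{d}}(\mathbf{x},\boldsymbol\rho)=&\sum_{m=1}^{M}\Big(\rho_k\big|[\mathbf{A}_k]_{mm}\big|^2+\sum_{i=1}^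{K}\Big(\frac{\rho_i\varrho_i}{\tau_p\varrho_k}\big|[\mathbf{R}_i\mathbf{R}_k\boldsymbol{\Psi}_k^{-1}]_{mm}\big|^2+\rho_i[\mathbf{R}_i]_{mm}[\mathbf{A}_k]_{mm}\Big)\Big)x_m\\&+\mathbf{x}^T\Big(\sum_{i=1}^{K}\frac{\rho_i\varrho_i}{\tau_p\varrho_k}\,\mathrm{abs}(\mathbf{R}_k\boldsymbol{\Psi}_k^{-1})^2\circ\mathrm{abs}(\mathbf{R}_i)^2\Big)\mathbf{x}+\mathrm{tr}\Big(\Big(\sum_{i=1}^{K}\rho_i\mathbf{R}_i+\sigma^2\mathbf{I}_M\Big)\mathbf{A}_k\Big).\end{aligned}$$
   Context: Notation. $\mathrm{diag}(\mathbf{X})$ is $\mathbf{X}$ with all off-diagonal entries set to zero; $\mathrm{abs}(\mathbf{X})^2$ is the matrix of entrywise squared absolute values; $\circ$ is the Hadamard (entrywise) product; $\mathbf{D}_\epsilon=\mathrm{diag}(\epsilon_1,\dots,\epsilon_M)$; $\mathbf{D}_{\mathbf{R}_i}=\mathrm{diag}(\mathbf{R}_i)$. The expression $\log_2(\zeta_m/\epsilon_m)$ is $+\infty$ if $\epsilon_m=0$. With $\boldsymbol\Psi_k$ fixed, define $$\overline{\mathrm{SINR}}_k(\boldsymbol\epsilon,\boldsymbol\rho)=\frac{\rho_k\left(\mathrm{tr}(\mathbf{R}_k\boldsymbol{\Psi}_k^{-1}\mathbf{R}_k)\right)^2}{S_k+T_k+U_k},$$ $$S_k=\rho_k\,\mathrm{tr}\Big(\mathbf{D}_{\epsilon}^2\,\mathrm{abs}\big(\mathrm{diag}(\mathbf{R}_k\boldsymbol{\Psi}_k^{-1}\mathbf{R}_k)\big)^2\Big),$$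 $$T_k=\sum_{i=1}^{K}\frac{\rho_i\varrho_i}{\tau_p\varrho_k}\,\mathrm{tr}\Big(\mathbf{D}_{\epsilon}^2\,\mathrm{abs}\big(\mathrm{diag}(\mathbf{R}_i\mathbf{R}_k\boldsymbol{\Psi}_k^{-1})\big)^2+\mathbf{D}_{\epsilon}^2\,\mathrm{diag}\big(\mathrm{abs}(\mathbf{R}_k\boldsymbol{\Psi}_k^{-1})^2\,\mathbf{D}_{\epsilon}^2\,\mathrm{abs}(\mathbf{R}_i)^2\big)\Big),$$ $$U_k=\mathrm{tr}\Big(\Big(\sum_{i=1}^{K}\rho_i\mathbf{R}_i+\sigma^2\mathbf{I}_M+\sum_{i=1}^{K}\rho_i\mathbf{D}_{\epsilon}^2\mathbf{D}_{\mathbf{R}_i}\Big)\mathbf{R}_k\boldsymbol{\Psi}_k^{-1}\mathbf{R}_k\Big).$$ A monomial in positive variables $u_1,\dots,u_n$ is $c\,u_1^{a_1}\cdots u_n^{a_n}$ with $c>0$ and $a_j\in\mathbb{R}$; a posynomial is a finite sum of monomials. A geometric program (in maximization form) maximizes a monomial over positive variables subject to constraints of the form posynomial $\le$ positive constant (monomials being special posynomials). *)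

(* Defs.v *)
From HB Require Import structures.
From mathcomp Require Import all_boot all_order all_algebra.
From mathcomp Require Import all_classical all_reals all_analysis.
From mathcomp Require Import complex.
Set Implicit Arguments.
Unset Strict Implicit.
Unset Printing Implicit Defensive.
Import Order.TTheory GRing.Theory Num.Theory.
Local Open Scope classical_set_scope.
Local Open Scope ring_scope.
Local Open Scope complex_scope.
Local Open Scope sesquilinear_scope.

Record maximization (R : realType) (T : Type) := Maximization {
  objective : T -> R;
  feasible : set T }.

(* Equals -oo when no point is feasible. *)
Definition optval (R : realType) (T : Type) (P : maximization R T) : \bar R :=
  ereal_sup [set (objective P z)%:E | z in feasible P].

Definition optimal (R : realType) (T : Type) (P : maximization R T) (z : T) :=
  feasible P z /\ forall z', feasible P z' -> objective P z' <= objective P z.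

Definition positive (R : realType) (I : finType) (u : I -> R) :=
  forall i, 0 < u i.

(* The values of a monomial or posynomial outside of the positive orthant are
   irrelevant. *)
Definition is_monomial (R : realType) (I : finType) (f : (I -> R) -> R) :=
  exists (c : R) (a : I -> R),
    0 < c /\ forall u, positive u -> f u = c * \prod_i u i `^ a i.

(* A sum of n + 1 >= 1 monomials: the zero function is not a posynomial. *)
Definition is_posynomial (R : realType) (I : finType) (f : (I -> R) -> R) :=
  exists (n : nat) (g : 'I_n.+1 -> (I -> R) -> R),
    (forall j, is_monomial (g j)) /\
    forall u, positive u -> f u = \sum_j g j u.

(* A pair [(g, c)] in [gp_constraints] stands for the constraint [g u <= c]. *)
Record positive_program (R : realType) (I : finType) := PositiveProgram {
  gp_objective : (I -> R) -> R;
  gp_constraints : seq (((I -> R) -> R) * R) }.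

Definition gp_maximization (R : realType) (I : finType)
    (G : positive_program R I) : maximization R (I -> R) :=
  Maximization (gp_objective G)
    [set u | positive u /\
             forall gc, gc \in gp_constraints G -> gc.1 u <= gc.2].

Definition is_geometric_program (R : realType) (I : finType)
    (G : positive_program R I) :=
  is_monomial (gp_objective G) /\
  forall gc, gc \in gp_constraints G -> is_posynomial gc.1 /\ 0 < gc.2.

Section ComplexMatrices.
Variables (R : realType) (n : nat).
Implicit Types X : 'M[R[i]]_n.

(* In [R[i]], [0 <= z] means that z is real and nonnegative. *)
Definition psdmx X :=
  X \is hermsymmx /\ forall v : 'cV[R[i]]_n, 0 <= (v ^t* *m X *m v) 0 0.

Definition pdmx X :=
  X \is hermsymmx /\
  forall v : 'cV[R[i]]_n, v != 0 -> 0 < (v ^t* *m X *m v) 0 0.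

Definition diag_part X : 'M[R[i]]_n := diag_mx (\row_j X j j).

Definition abs2 X : 'M[R[i]]_n := map_mx (fun z => `|z| ^+ 2) X.

Definition real_diag (d : 'I_n -> R) : 'M[R[i]]_n := diag_mx (\row_j (d j)%:C).

Definition hadamard X Y : 'M[R[i]]_n := map2_mx *%R X Y.

End ComplexMatrices.

(* [Rm k] is the covariance matrix R_k, [Psi k] the matrix Psi_k; [sigma2] is
   sigma^2. *)
Record system (R : realType) (M K : nat) := System {
  Rm : 'I_K -> 'M[R[i]]_M;
  Psi : 'I_K -> 'M[R[i]]_M;
  tau_p : R;
  varrho : 'I_K -> R;
  sigma2 : R;
  zeta : 'I_M -> R;
  b_tot : R;
  eps_max : R;
  rho_max : R }.

Section SINR.
Variables (R : realType) (M K : nat) (s : system R M K).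
Implicit Types (k i : 'I_K) (eps x : 'I_M -> R) (rho : 'I_K -> R).

Definition Amx k : 'M[R[i]]_M := Rm s k *m invmx (Psi s k) *m Rm s k.

Definition S_ eps rho k : R[i] :=
  (rho k)%:C * \tr (real_diag eps ^+ 2 *m abs2 (diag_part (Amx k))).

Definition T_ eps rho k : R[i] :=
  \sum_(i < K) (rho i * varrho s i / (tau_p s * varrho s k))%:C *
    \tr (real_diag eps ^+ 2 *m
           abs2 (diag_part (Rm s i *m Rm s k *m invmx (Psi s k))) +
         real_diag eps ^+ 2 *m
           diag_part (abs2 (Rm s k *m invmx (Psi s k)) *m
                      real_diag eps ^+ 2 *m abs2 (Rm s i))).

Definition U_ eps rho k : R[i] :=
  \tr ((\sum_(i < K) (rho i)%:C *: Rm s i + (sigma2 s)%:C%:M +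
        \sum_(i < K) (rho i)%:C *:
          (real_diag eps ^+ 2 *m diag_part (Rm s i))) *m Amx k).

Definition sinrC eps rho k : R[i] :=
  (rho k)%:C * \tr (Amx k) ^+ 2 /
  (S_ eps rho k + T_ eps rho k + U_ eps rho k).

(* The complex formulas [sinrC], [fdC] and [wC] take real values, see
   [sinrC_real], [fdC_real] and [wC_real]; [complex.Re] only changes their
   type. *)
Definition sinr eps rho k : R := complex.Re (sinrC eps rho k).

Definition wC k : R[i] := \tr (Amx k) ^+ 2.

Definition w k : R := complex.Re (wC k).

Definition fdC x rho k : R[i] :=
  \sum_(m < M)
    ((rho k)%:C * `|Amx k m m| ^+ 2 +
     \sum_(i < K)
       ((rho i * varrho s i / (tau_p s * varrho s k))%:C *
          `|(Rm s i *m Rm s k *m invmx (Psi s k)) m m| ^+ 2 +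
        (rho i)%:C * Rm s i m m * Amx k m m)) * (x m)%:C
  + ((\col_m (x m)%:C)^T *m
     (\sum_(i < K) (rho i * varrho s i / (tau_p s * varrho s k))%:C *:
        hadamard (abs2 (Rm s k *m invmx (Psi s k))) (abs2 (Rm s i))) *m
     \col_m (x m)%:C) 0 0
  + \tr ((\sum_(i < K) (rho i)%:C *: Rm s i + (sigma2 s)%:C%:M) *m Amx k).

Definition fd x rho k : R := complex.Re (fdC x rho k).

Definition log2 (r : R) : R := ln r / ln 2.

Definition bits eps m : \bar R :=
  if eps m == 0 then +oo%E else (log2 (zeta s m / eps m))%:E.

Definition allocation : set (('I_M -> R) * ('I_K -> R)) :=
  [set er | [/\ (\sum_(m < M) bits er.1 m - (b_tot s)%:E <= 0)%E,
                forall m, 0 <= er.1 m <= eps_max s &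
                forall k, 0 <= er.2 k <= rho_max s]].

Definition max_product : maximization R (('I_M -> R) * ('I_K -> R)) :=
  Maximization (fun er => \prod_(k < K) sinr er.1 er.2 k) allocation.

(* The minimum over a nonempty index set; the value at the first index serves
   as the unit of the iterated minimum. *)
Definition min_ord (K_gt0 : (0 < K)%N) (F : 'I_K -> R) : R :=
  \big[Order.min/F (Ordinal K_gt0)]_(k < K) F k.

Definition max_min (K_gt0 : (0 < K)%N) :
    maximization R (('I_M -> R) * ('I_K -> R)) :=
  Maximization (fun er => min_ord K_gt0 (sinr er.1 er.2)) allocation.

(* The variables t, x_1, ..., x_M, rho_1, ..., rho_K. *)
Definition gpvar := (unit + 'I_M + 'I_K)%type.

Definition tvar (u : gpvar -> R) : R := u (inl (inl tt)).
Definition xvar (u : gpvar -> R) : 'I_M -> R := fun m => u (inl (inr m)).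
Definition rhovar (u : gpvar -> R) : 'I_K -> R := fun k => u (inr k).

Definition gppoint (t : R) x rho : gpvar -> R := fun v =>
  match v with
  | inl (inl _) => t
  | inl (inr m) => x m
  | inr k => rho k
  end.

Definition common_constraints : seq (((gpvar -> R) -> R) * R) :=
  ((fun u => \prod_(m < M) (zeta s m ^+ 2 * (xvar u m)^-1)),
   2 `^ (2 * b_tot s))
  :: [seq ((fun u => xvar u m), eps_max s ^+ 2) | m <- enum 'I_M]
  ++ [seq ((fun u => rhovar u k), rho_max s) | k <- enum 'I_K].

Definition max_product_gp : positive_program R gpvar := {|
  gp_objective := fun u => tvar u * \prod_(k < K) (rhovar u k * w k);
  gp_constraints :=
    ((fun u => tvar u * \prod_(k < K) fd (xvar u) (rhovar u) k), 1)
    :: common_constraints |}.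

Definition max_min_gp : positive_program R gpvar := {|
  gp_objective := fun u => tvar u;
  gp_constraints :=
    [seq ((fun u =>
             tvar u * fd (xvar u) (rhovar u) k / (rhovar u k * w k)), 1)
       | k <- enum 'I_K]
    ++ common_constraints |}.

(* Equivalence under the change of variables x_m = eps_m ^ 2. *)
Definition equivalent (P : maximization R (('I_M -> R) * ('I_K -> R)))
    (G : positive_program R gpvar) :=
  [/\ optval P = optval (gp_maximization G),
      forall eps rho, optimal P (eps, rho) ->
        exists t,
          optimal (gp_maximization G) (gppoint t (fun m => eps m ^+ 2) rho) &
      forall t x rho, optimal (gp_maximization G) (gppoint t x rho) ->
        optimal P (fun m => Num.sqrt (x m), rho)].

Section RealValues.
Hypothesis Rm_herm : forall k, Rm s k \is hermsymmx.
Hypothesis Psi_herm : forall k, Psi s k \is hermsymmx.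

Let hermE n (X : 'M[R[i]]_n) : X \is hermsymmx -> X ^t* = X.
Proof. by rewrite is_hermitianmxE expr0 scale1r => /eqP <-. Qed.

Let realC (r : R) : r%:C \is @Num.real R[i].
Proof. by rewrite complex_real. Qed.

Let Amx_herm k : Amx k ^t* = Amx k.
Proof.
by rewrite /Amx !trmx_mul !map_mxM /= trmx_inv map_invmx !hermE// mulmxA.
Qed.

Let real_diag_real d : real_diag d \is a @mxOver M M _ (@Num.real R[i]).
Proof. by apply/mxOverP => i j; rewrite !mxE rpredMn. Qed.

Let abs2_real X : abs2 X \is a @mxOver M M _ (@Num.real R[i]).
Proof. by apply/mxOverP => i j; rewrite mxE rpredX // normr_real. Qed.

Let diag_part_real (X : 'M[R[i]]_M) : (forall j, X j j \is Num.real) ->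
  diag_part X \is a @mxOver M M _ (@Num.real R[i]).
Proof. by move=> Xr; apply/mxOverP => i j; rewrite !mxE rpredMn. Qed.

Let tr_real (X : 'M[R[i]]_M) :
  X \is a mxOver (@Num.real R[i]) -> \tr X \is Num.real.
Proof. by move=> /mxOverP Xr; apply: rpred_sum. Qed.

Let mulmx_real m n p (X : 'M[R[i]]_(m, n)) (Y : 'M[R[i]]_(n, p)) :
  X \is a mxOver (@Num.real R[i]) -> Y \is a mxOver (@Num.real R[i]) ->
  X *m Y \is a mxOver (@Num.real R[i]).
Proof.
move=> /mxOverP Xr /mxOverP Yr; apply/mxOverP => i j; rewrite mxE.
by apply: rpred_sum => l _; apply: rpredM.
Qed.

Let herm_diag_real (X : 'M[R[i]]_M) m : X ^t* = X -> X m m \is Num.real.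
Proof. by move=> XH; apply/CrealP; rewrite -[in RHS]XH !mxE. Qed.

Let herm_tr_real (X Y : 'M[R[i]]_M) :
  X ^t* = X -> Y ^t* = Y -> \tr (X *m Y) \is Num.real.
Proof.
move=> XH YH; apply/CrealP.
rewrite -trace_map_mx -mxtrace_tr map_trmx trmx_mul map_mxM /= XH YH.
exact: mxtrace_mulC.
Qed.

Let conjD (X Y : 'M[R[i]]_M) : (X + Y) ^t* = X ^t* + Y ^t*.
Proof. by apply/matrixP => i j; rewrite !mxE rmorphD. Qed.

Let scale_herm (r : R) (X : 'M[R[i]]_M) :
  X ^t* = X -> (r%:C *: X) ^t* = r%:C *: X.
Proof.
move=> XH; rewrite -[in RHS]XH; apply/matrixP => i j.
by rewrite !mxE rmorphM /= (CrealP (realC r)).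
Qed.

Let sum_herm (F : 'I_K -> 'M[R[i]]_M) :
  (forall i, (F i) ^t* = F i) -> (\sum_i F i) ^t* = \sum_i F i.
Proof.
move=> FH; apply: (big_ind (fun X : 'M[R[i]]_M => (X ^t*) = X)) => //.
  by apply/matrixP => i j; rewrite !mxE rmorph0.
by move=> X Y XH YH; rewrite conjD XH YH.
Qed.

Let noise_herm rho : (\sum_(i < K) (rho i)%:C *: Rm s i + (sigma2 s)%:C%:M) ^t*
  = \sum_(i < K) (rho i)%:C *: Rm s i + (sigma2 s)%:C%:M.
Proof.
rewrite conjD; congr (_ + _).
  by apply: sum_herm => i; apply/scale_herm/hermE.
rewrite -[((sigma2 s)%:C%:M)]scalemx1; apply: scale_herm.
by rewrite trmx1 map_mx1.
Qed.

Lemma wC_real k : wC k \is Num.real.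
Proof. by apply: rpredX; apply: rpred_sum => m _; exact: herm_diag_real. Qed.

Lemma sinrC_real eps rho k : sinrC eps rho k \is Num.real.
Proof.
have DR : real_diag eps ^+ 2 \is a mxOver (@Num.real R[i]).
  by rewrite expr2 -mulmxE; exact: mulmx_real.
have tr_real_mul X : X \is a mxOver (@Num.real R[i]) ->
    \tr (real_diag eps ^+ 2 *m X) \is Num.real.
  by move=> Xr; exact: tr_real (mulmx_real DR Xr).
apply: rpred_div; first by apply: rpredM (realC _) (wC_real k).
apply: rpredD; first apply: rpredD.
- exact: rpredM (realC _) (tr_real_mul _ (abs2_real _)).
- apply: rpred_sum => i _; apply: rpredM (realC _) _; rewrite mxtraceD.
  apply: rpredD; first exact: tr_real_mul (abs2_real _).
  apply/tr_real_mul/diag_part_real => j.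
  exact: (mxOverP (mulmx_real (mulmx_real (abs2_real _) DR) (abs2_real _))).
- apply: herm_tr_real => //; rewrite conjD noise_herm; congr (_ + _).
  apply: sum_herm => i; apply: scale_herm; apply/matrixP => a b.
  rewrite /real_diag expr2 -mulmxE -mulmxA !mul_diag_mx !mxE.
  rewrite !rmorphM /= rmorphMn /= !(CrealP (realC _)).
  rewrite (CrealP (herm_diag_real _ (hermE (Rm_herm i)))).
  have [->|ab] := eqVneq b a; first by rewrite ?eqxx.
  by rewrite ?(negPf ab) 1?eq_sym ?(negPf ab) ?mulr0n ?mulr0.
Qed.

Lemma fdC_real x rho k : fdC x rho k \is Num.real.
Proof.
apply: rpredD; last exact: herm_tr_real.
apply: rpredD.
- apply: rpred_sum => m _.
  rewrite rpredM// rpredD ?rpredM ?rpredX ?normr_real//.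
  apply: rpred_sum => i _.
  rewrite rpredD ?rpredM ?rpredX ?normr_real// herm_diag_real//.
  exact: hermE.
- have xR : \col_m (x m)%:C \is a @mxOver M 1 _ (@Num.real R[i]).
    by apply/mxOverP => i j; rewrite mxE.
  have xTR : (\col_m (x m)%:C)^T \is a @mxOver 1 M _ (@Num.real R[i]).
    by apply/mxOverP => i j; rewrite !mxE.
  apply: (mxOverP (mulmx_real (mulmx_real xTR _) xR)).
  apply/mxOverP => a b; rewrite summxE; apply: rpred_sum => i _.
  by rewrite !mxE !rpredM ?rpredX ?normr_real.
Qed.

End RealValues.

End SINR.

(* Main.v *)
(* Since R_k and Psi_k are positive (semi)definite, so is A_k, and every
   coefficient of f_k^d is nonnegative, the constant one sigma^2 tr(A_k) being
   positive; the traces tr(R_i A_k) are nonnegative by diagonalizing R_i. With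
   x_m = eps_m^2 the denominator of the SINR is exactly f_k^d(x, rho), so that
   SINR_k = rho_k w_k / f_k^d.  In both geometric programs t is an epigraph
   variable whose largest feasible value makes the objective equal to the
   original one. The geometric programs only lose the points with some
   eps_m = 0, which cost infinitely many bits, and those with some rho_k = 0,
   whose objective vanishes whereas full power yields a positive one. *)
Require Import Defs.
From HB Require Import structures.
From mathcomp Require Import all_boot all_order all_algebra.
From mathcomp Require Import all_classical all_reals all_analysis.
From mathcomp Require Import complex.
Set Implicit Arguments.
Unset Strict Implicit.
Unset Printing Implicit Defensive.
Import Order.TTheory GRing.Theory Num.Theory.
Local Open Scope ring_scope.

(** * Positive semidefinite and positive definite Hermitian matrices *)

Section PositiveMatrices.
Context {R : realType} {n : nat}.
Implicit Types X Y : 'M[R[i]]_n.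
Local Open Scope sesquilinear_scope.

Lemma hermsymmxP X : reflect (X ^t* = X) (X \is hermsymmx).
Proof.
by rewrite is_hermitianmxE expr0 scale1r eq_sym; exact: eqP.
Qed.

Lemma pdmx_psd X : pdmx X -> psdmx X.
Proof.
case=> Xherm Xpd; split=> // v; have [->|v0] := eqVneq v 0.
  by rewrite mulmx0 mxE.
exact/ltW/Xpd.
Qed.

(** The entry is the quadratic form of [X] at the conjugate transpose of row [j] of [P]. *)
Lemma psdmx_congr_diag m X (P : 'M[R[i]]_(m, n)) j :
  psdmx X -> 0 <= (P *m X *m P ^t*) j j.
Proof.
move=> [_ /(_ ((row j P) ^t*))]; rewrite trmxCK -row_mul.
rewrite !mxE; under eq_bigr do rewrite !mxE.
by under [X in _ -> 0 <= X]eq_bigr do rewrite !mxE.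
Qed.

(** Same quadratic form as in the semidefinite case; a nonzero row gives a nonzero vector, hence a
    strict inequality. *)
Lemma pdmx_congr_diag m X (P : 'M[R[i]]_(m, n)) j :
  pdmx X -> row j P != 0 -> 0 < (P *m X *m P ^t*) j j.
Proof.
move=> [_ /(_ ((row j P) ^t*))]; rewrite trmxCK -row_mul => Xpd Pj0.
suff /Xpd : (row j P) ^t* != 0.
  rewrite !mxE; under eq_bigr do rewrite !mxE.
  by under [X in _ -> 0 < X]eq_bigr do rewrite !mxE.
by apply: contraNneq Pj0 => P0; rewrite -[row j P]trmxCK P0 trmx0 map_mx0.
Qed.

Lemma psdmx_diag_ge0 X j : psdmx X -> 0 <= X j j.
Proof.
by move=> /(psdmx_congr_diag 1%:M j); rewrite trmx1 map_mx1 mul1mx mulmx1.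
Qed.

Lemma pdmx_unit X : pdmx X -> X \in unitmx.
Proof.
(* A singular [X] kills a nonzero row vector [v], so its form vanishes at the nonzero vector
   [v ^t*]. *)
move=> [_ Xpd]; rewrite unitmxE unitfE; apply/negP => /det0P[v v0 vX0].
suff /Xpd : v ^t* != 0 by rewrite trmxCK vX0 mul0mx mxE ltxx.
by apply: contraNneq v0 => P0; rewrite -[v]trmxCK P0 trmx0 map_mx0.
Qed.

Lemma pdmx_inv X : pdmx X -> pdmx (invmx X).
Proof.
move=> Xpd; have Xunit := pdmx_unit Xpd; have [/hermsymmxP Xherm Xpos] := Xpd.
have XVherm : (invmx X) ^t* = invmx X by rewrite trmx_inv map_invmx Xherm.
split=> [|v v0]; first exact/hermsymmxP.
(* The form of the inverse at [v] is the form of [X] at [invmx X *m v], which is nonzero whenever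
   [v] is. *)
have -> : v ^t* *m invmx X *m v = (invmx X *m v) ^t* *m X *m (invmx X *m v).
  by rewrite trmx_mul map_mxM /= XVherm !mulmxA mulmxKV.
apply: Xpos; apply: contraNneq v0 => XVv0.
by rewrite -(mulKVmx Xunit v) XVv0 mulmx0.
Qed.

(* Diagonalizing X as P^* D P turns the trace into the sum of the products of
   the diagonal entries of P X P^* and P Y P^*. *)
Lemma psdmx_trM_ge0 X Y : psdmx X -> psdmx Y -> 0 <= \tr (X *m Y).
Proof.
move=> Xpsd Ypsd; have Xherm := Xpsd.1.
have PU := spectral_unitarymx X; set P := spectralmx X in PU.
have Xdiag := orthomx_spectralP (hermitian_normalmx Xherm).
rewrite /= -/P in Xdiag; set d := spectral_diag X in Xdiag.
have PV : invmx P = P ^t* by rewrite invmx_unitary.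
have Dd : P *m X *m P ^t* = diag_mx d.
  by rewrite Xdiag -PV !mulmxA mulmxV ?unitarymx_unit//
    mul1mx mulmxK ?unitarymx_unit.
rewrite Xdiag PV -!mulmxA mxtrace_mulC -mulmxA.
rewrite mul_diag_mx /mxtrace sumr_ge0// => j _; rewrite mxE mulr_ge0//.
  by have := psdmx_congr_diag P j Xpsd; rewrite Dd !mxE eqxx mulr1n.
exact: psdmx_congr_diag.
Qed.

End PositiveMatrices.

(** * Closure properties of monomials and posynomials *)

Section Posynomials.
Context {R : realType} {I : finType}.
Implicit Types (f g : (I -> R) -> R) (F G : (I -> R) -> R[i]).

(** A monomial is kept as data, a coefficient and an exponent vector, so that lists of them can be
    concatenated for sums and paired for products. *)
Definition monomial_at (p : R * (I -> R)) (u : I -> R) := p.1 * \prod_i u i `^ p.2 i.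

Lemma is_monomial_cst (c : R) : 0 < c -> is_monomial (fun _ : I -> R => c).
Proof.
move=> c_gt0; exists c, (fun=> 0); split=> // u _.
by rewrite big1 ?mulr1// => i _; rewrite powRr0.
Qed.

Lemma is_monomial_var (i : I) : is_monomial (fun u : I -> R => u i).
Proof.
exists 1, (fun j => (j == i)%:R); split=> // u u_gt0.
rewrite mul1r (bigD1 i)//= eqxx powRr1 ?(ltW (u_gt0 i))// big1 ?mulr1//.
by move=> j /negPf->; rewrite powRr0.
Qed.

Lemma is_monomialV f : is_monomial f -> is_monomial (fun u => (f u)^-1).
Proof.
move=> [c [a [c_gt0 fE]]]; exists c^-1, (fun i => - a i).
split=> [|u u_gt0]; first by rewrite invr_gt0.
rewrite fE// invfM; congr (_ * _).
by rewrite -prodfV; apply: eq_bigr => i _; rewrite powRN.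
Qed.

Lemma is_monomialM f g :
  is_monomial f -> is_monomial g -> is_monomial (fun u => f u * g u).
Proof.
move=> [c [a [c_gt0 fE]]] [d [b [d_gt0 gE]]].
exists (c * d), (fun i => a i + b i); split=> [|u u_gt0]; first exact: mulr_gt0.
rewrite fE// gE// mulrACA -big_split; congr (_ * _).
by apply: eq_bigr => i _; rewrite powRD// (gt_eqF (u_gt0 i)) implybT.
Qed.

Lemma is_monomial_prod (J : Type) (r : seq J) (h : J -> (I -> R) -> R) :
  (forall j, is_monomial (h j)) -> is_monomial (fun u => \prod_(j <- r) h j u).
Proof.
move=> hmono; elim: r => [|j r IHr].
  by under eq_fun do rewrite big_nil; exact: is_monomial_cst.
by under eq_fun do rewrite big_cons; exact: is_monomialM.
Qed.

Lemma is_monomial_posynomial f : is_monomial f -> is_posynomial f.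
Proof.
move=> fmono; exists 0%N, (fun=> f); split=> // u _.
by rewrite big_ord1.
Qed.

(* Allowing the empty sum lets the coefficients of [fd] be zero: being a genuine
   posynomial is then a matter of not vanishing at one positive point. *)
Definition is_posynomial0 f := exists s : seq (R * (I -> R)),
  {in s, forall p, 0 < p.1} /\
  forall u, positive u -> f u = \sum_(p <- s) monomial_at p u.

Lemma is_posynomial0_posynomial f :
  is_posynomial0 f -> 0 < f (fun=> 1) -> is_posynomial f.
Proof.
move=> [[|p s] [s_gt0 fE]]; first by rewrite fE ?big_nil ?ltxx.
(* The list [p :: s] has [(size s).+1] entries, which is the index type ['I_n.+1] for
   [n = size s]. *)
move=> _; exists (size s), (fun j => monomial_at (nth p (p :: s) j)).
split=> [j|u u0].
  exists (nth p (p :: s) j).1, (nth p (p :: s) j).2; split=> //.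
  by apply: s_gt0; rewrite mem_nth.
by rewrite fE// (big_nth p) big_mkord.
Qed.

Lemma is_monomial_posynomial0 f : is_monomial f -> is_posynomial0 f.
Proof.
move=> [c [a [c_gt0 fE]]]; exists [:: (c, a)]; split=> [p|u u_gt0].
  by rewrite inE => /eqP ->.
by rewrite big_seq1 fE.
Qed.

Lemma is_posynomial0_cst (c : R) : 0 <= c -> is_posynomial0 (fun=> c).
Proof.
rewrite le_eqVlt => /predU1P[<-|c_gt0].
  by exists [::]; split=> // u _; rewrite big_nil.
exact/is_monomial_posynomial0/is_monomial_cst.
Qed.

Lemma is_posynomial0D f g :
  is_posynomial0 f -> is_posynomial0 g -> is_posynomial0 (fun u => f u + g u).
Proof.
move=> [s [s_gt0 fE]] [s' [s'_gt0 gE]]; exists (s ++ s'); split=> [p|u u_gt0].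
  by rewrite mem_cat => /orP[/s_gt0|/s'_gt0].
by rewrite big_cat fE// gE.
Qed.

Lemma is_posynomial0M f g :
  is_posynomial0 f -> is_posynomial0 g -> is_posynomial0 (fun u => f u * g u).
Proof.
move=> [s [s_gt0 fE]] [s' [s'_gt0 gE]].
exists [seq (p.1 * q.1, fun i => p.2 i + q.2 i) | p <- s, q <- s'].
split=> [_ /allpairsP[[p q] [/s_gt0 p_gt0 /s'_gt0 q_gt0 ->]]|u u_gt0].
  exact: mulr_gt0.
rewrite big_allpairs_dep fE// gE// big_distrlr; apply: eq_bigr => p _.
apply: eq_bigr => q _; rewrite /monomial_at /= mulrACA -big_split; congr (_ * _).
by apply: eq_bigr => i _; rewrite powRD// (gt_eqF (u_gt0 i)) implybT.
Qed.

Lemma is_posynomial0_prod (J : Type) (r : seq J) (h : J -> (I -> R) -> R) :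
  (forall j, is_posynomial0 (h j)) ->
  is_posynomial0 (fun u => \prod_(j <- r) h j u).
Proof.
move=> hpos; elim: r => [|j r IHr].
  by under eq_fun do rewrite big_nil; exact: is_posynomial0_cst.
by under eq_fun do rewrite big_cons; exact: is_posynomial0M.
Qed.

(** Since [fd] is the real part of a complex formula, closure is established on the complex side,
    operation by operation; [complex.Re] then only removes the embedding of the reals. *)
Definition is_posynomialC F := exists2 f, is_posynomial0 f &
  forall u, positive u -> F u = (f u)%:C%C.

Lemma is_posynomialC_Re F :
  is_posynomialC F -> is_posynomial0 (fun u => complex.Re (F u)).
Proof.
move=> [f [s [s_gt0 fE]] FE]; exists s; split=> // u u_gt0.
by rewrite FE//= fE.
Qed.

Lemma is_posynomialC_cst (z : R[i]) : 0 <= z -> is_posynomialC (fun=> z).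
Proof.
move=> z_ge0; have zE := RRe_real (ger0_real z_ge0).
exists (fun=> complex.Re z) => //; apply: is_posynomial0_cst.
by rewrite -lecR zE.
Qed.

Lemma is_posynomialC_real f :
  is_posynomial0 f -> is_posynomialC (fun u => (f u)%:C%C).
Proof. by exists f. Qed.

Lemma is_posynomialC_var (i : I) : is_posynomialC (fun u => (u i)%:C%C).
Proof. exact/is_posynomialC_real/is_monomial_posynomial0/is_monomial_var. Qed.

Lemma is_posynomialCD F G :
  is_posynomialC F -> is_posynomialC G -> is_posynomialC (fun u => F u + G u).
Proof.
move=> [f f0 FE] [g g0 GE]; exists (fun u => f u + g u).
  exact: is_posynomial0D.
by move=> u u_gt0; rewrite FE// GE// rmorphD.
Qed.

Lemma is_posynomialCM F G :
  is_posynomialC F -> is_posynomialC G -> is_posynomialC (fun u => F u * G u).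
Proof.
move=> [f f0 FE] [g g0 GE]; exists (fun u => f u * g u).
  exact: is_posynomial0M.
by move=> u u_gt0; rewrite FE// GE// rmorphM.
Qed.

Lemma is_posynomialC_sum (J : Type) (r : seq J) (H : J -> (I -> R) -> R[i]) :
  (forall j, is_posynomialC (H j)) ->
  is_posynomialC (fun u => \sum_(j <- r) H j u).
Proof.
move=> Hpos; elim: r => [|j r IHr].
  by under eq_fun do rewrite big_nil; exact: is_posynomialC_cst.
by under eq_fun do rewrite big_cons; exact: is_posynomialCD.
Qed.

End Posynomials.

(** * The SINR as a quotient, and the sign and posynomial structure of its denominator *)

Section SINRasRatio.
Context {R : realType} {M K : nat}.
Variable s : system R M K.
Hypothesis Rm_psd : forall k, psdmx (Rm s k).
Implicit Types (k i : 'I_K) (m : 'I_M) (eps x : 'I_M -> R) (rho : 'I_K -> R).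
Local Open Scope complex_scope.

Let coef rho k i : R[i] :=
  (rho i * varrho s i / (tau_p s * varrho s k))%:C.

Let noise rho : 'M[R[i]]_M :=
  \sum_(i < K) (rho i)%:C *: Rm s i + (sigma2 s)%:C%:M.

Let real_diag_sqr eps :
  real_diag eps ^+ 2 = diag_mx (\row_m (eps m ^+ 2)%:C).
Proof.
rewrite /real_diag expr2 -mulmxE mulmx_diag; congr diag_mx.
by apply/rowP => m; rewrite !mxE expr2 rmorphM.
Qed.

Let tr_real_diag_sqr eps (X : 'M[R[i]]_M) :
  \tr (real_diag eps ^+ 2 *m X) = \sum_m X m m * (eps m ^+ 2)%:C.
Proof.
rewrite real_diag_sqr mul_diag_mx /mxtrace.
by apply: eq_bigr => m _; rewrite !mxE mulrC.
Qed.

Lemma S_E eps rho k : S_ s eps rho k =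
  \sum_m (rho k)%:C * `|Amx s k m m| ^+ 2 * (eps m ^+ 2)%:C.
Proof.
rewrite /S_ tr_real_diag_sqr mulr_sumr; apply: eq_bigr => m _.
by rewrite !mxE eqxx mulr1n mulrA.
Qed.

Lemma T_E eps rho k : T_ s eps rho k =
  \sum_m (\sum_i coef rho k i *
    `|(Rm s i *m Rm s k *m invmx (Psi s k)) m m| ^+ 2) * (eps m ^+ 2)%:C +
  ((\col_m (eps m ^+ 2)%:C)^T *m
     (\sum_i coef rho k i *:
        hadamard (abs2 (Rm s k *m invmx (Psi s k))) (abs2 (Rm s i))) *m
     \col_m (eps m ^+ 2)%:C) 0 0.
Proof.
(* Each user's contribution splits into a part linear in the squares [eps m ^+ 2] and a part
   quadratic in them. *)
have -> : T_ s eps rho k = \sum_i (coef rho k i *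
    \sum_m `|(Rm s i *m Rm s k *m invmx (Psi s k)) m m| ^+ 2 * (eps m ^+ 2)%:C +
  coef rho k i * \sum_m \sum_j (eps m ^+ 2)%:C * (eps j ^+ 2)%:C *
    (`|(Rm s k *m invmx (Psi s k)) m j| ^+ 2 * `|Rm s i m j| ^+ 2)).
  apply: eq_bigr => i _; rewrite mxtraceD mulrDr; congr (_ * _ + _ * _).
    rewrite tr_real_diag_sqr; apply: eq_bigr => m _.
    by rewrite !mxE eqxx mulr1n.
  rewrite tr_real_diag_sqr; apply: eq_bigr => m _.
  rewrite real_diag_sqr mul_mx_diag !mxE eqxx mulr1n mulrC mulr_sumr.
  (* The matrix product produces the entry of [Rm s i] at [j m]; Hermitian symmetry gives it the
     modulus of the entry at [m j], which turns the product into a Hadamard one. *)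
  apply: eq_bigr => j _; have /hermsymmxP Rherm := (Rm_psd i).1.
  rewrite -{1}Rherm !mxE norm_conjC -[RHS]mulrA; congr (_ * _).
  by rewrite -[LHS]mulrA mulrCA.
rewrite big_split /=; congr (_ + _).
  under eq_bigr do rewrite mulr_sumr; rewrite exchange_big.
  apply: eq_bigr => m _; rewrite mulr_suml.
  by apply: eq_bigr => i _; rewrite mulrA.
rewrite mulmx_sumr mulmx_suml summxE; apply: eq_bigr => i _.
rewrite -scalemxAr -scalemxAl mxE; congr (_ * _); rewrite mxE exchange_big.
apply: eq_bigr => j _; rewrite mxE mulr_suml; apply: eq_bigr => m _.
by rewrite !mxE mulrAC.
Qed.

Lemma U_E eps rho k : U_ s eps rho k =
  \sum_m (\sum_i (rho i)%:C * Rm s i m m * Amx s k m m) * (eps m ^+ 2)%:C +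
  \tr (noise rho *m Amx s k).
Proof.
rewrite /U_ mulmxDl mxtraceD addrC; congr (_ + _).
under eq_bigr do rewrite scalemxAr; rewrite -mulmx_sumr -mulmxA tr_real_diag_sqr.
apply: eq_bigr => m _; congr (_ * _).
rewrite mulmx_suml summxE; apply: eq_bigr => i _.
by rewrite -scalemxAl mul_diag_mx !mxE mulrA.
Qed.

(** The linear parts of the three terms merge into one sum over [m]; the quadratic form comes from
    [T_] alone and the constant trace from [U_] alone. *)
Lemma denominator_fdC eps rho k :
  S_ s eps rho k + T_ s eps rho k + U_ s eps rho k =
  fdC s (fun m => eps m ^+ 2) rho k.
Proof.
rewrite S_E T_E U_E [LHS]addrA /fdC; congr (_ + _).
rewrite [X in X + _ = _]addrA [LHS]addrAC; congr (_ + _); rewrite -!big_split.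
apply: eq_bigr => m _ /=; rewrite -!mulrDl; congr (_ * _).
by rewrite -addrA; congr (_ + _); rewrite -big_split.
Qed.

Hypothesis Psi_pd : forall k, pdmx (Psi s k).

Lemma sinrE eps rho k :
  sinr s eps rho k = rho k * w s k / fd s (fun m => eps m ^+ 2) rho k.
Proof.
have Rherm i := (Rm_psd i).1; have Psi_herm i := (Psi_pd i).1.
rewrite /sinr /sinrC denominator_fdC -/(wC s k).
(* Numerator and denominator are embedded reals, so the complex quotient is the embedding of the
   real one. *)
rewrite -(RRe_real (wC_real Rherm Psi_herm k)).
rewrite -(RRe_real (fdC_real Rherm Psi_herm _ rho k)).
by rewrite -rmorphM -fmorphV -rmorphM.
Qed.

Local Open Scope sesquilinear_scope.

Let Amx_congr k : Amx s k = Rm s k *m invmx (Psi s k) *m (Rm s k) ^t*.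
Proof. by rewrite (hermsymmxP _ (Rm_psd k).1). Qed.

Lemma Amx_psd k : psdmx (Amx s k).
Proof.
rewrite Amx_congr.
have PsiV_psd := pdmx_psd (pdmx_inv (Psi_pd k)).
split=> [|v].
  apply/hermsymmxP; rewrite !trmx_mul !map_mxM /= trmxCK.
  by rewrite (hermsymmxP _ PsiV_psd.1) mulmxA.
(* The form of [Amx s k] at [v] becomes the single entry of a congruence of [invmx (Psi s k)] by the
   row [v^t* *m Rm s k]. *)
rewrite !mulmxA -[_ *m _ *m invmx _ *m _ *m v]mulmxA.
have -> : (Rm s k)^t* *m v = (v^t* *m Rm s k)^t*.
  by rewrite trmx_mul map_mxM /= trmxCK.
exact: psdmx_congr_diag.
Qed.

Hypothesis Rm_neq0 : forall k, Rm s k != 0.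

(** A nonzero row of [Rm s k] makes the corresponding diagonal entry of the congruence strictly
    positive; the other diagonal entries are nonnegative. *)
Lemma tr_Amx_gt0 k : 0 < \tr (Amx s k).
Proof.
have [m Rm0] : exists m, row m (Rm s k) != 0.
  apply/existsP; apply: contraNT (Rm_neq0 k) => /existsPn R0.
  by apply/eqP/row_matrixP => m; rewrite row0; exact/eqP/negPn/R0.
rewrite /mxtrace (bigD1 m)//= ltr_pwDl//.
  by rewrite Amx_congr pdmx_congr_diag//; exact: pdmx_inv.
by apply: sumr_ge0 => j _; exact/psdmx_diag_ge0/Amx_psd.
Qed.

Lemma w_gt0 k : 0 < w s k.
Proof.
by rewrite -ltcR RRe_real; rewrite ?ger0_real ?exprn_ge0 ?exprn_gt0 ?ltW ?tr_Amx_gt0.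
Qed.

Hypothesis tau_p_gt0 : 0 < tau_p s.
Hypothesis varrho_gt0 : forall k, 0 < varrho s k.
Hypothesis sigma2_gt0 : 0 < sigma2 s.

Let ge0C (r : R) : 0 <= r -> 0 <= r%:C :> R[i].
Proof. by rewrite lecR. Qed.

Let tr_noise rho k : \tr (noise rho *m Amx s k) =
  \sum_i (rho i)%:C * \tr (Rm s i *m Amx s k) + (sigma2 s)%:C * \tr (Amx s k).
Proof.
rewrite mulmxDl mxtraceD mul_scalar_mx mxtraceZ; congr (_ + _).
rewrite mulmx_suml raddf_sum; apply: eq_bigr => i _ /=.
by rewrite -scalemxAl mxtraceZ.
Qed.

(** The expanded double sum displays nonnegative coefficients, for both the positivity of [fd] and
    its posynomial form. *)
Let quadE x rho k : ((\col_m (x m)%:C)^T *m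
     (\sum_i coef rho k i *:
        hadamard (abs2 (Rm s k *m invmx (Psi s k))) (abs2 (Rm s i))) *m
     \col_m (x m)%:C) 0 0 =
  \sum_m (\sum_j (x j)%:C * \sum_i coef rho k i *
    (`|(Rm s k *m invmx (Psi s k)) j m| ^+ 2 * `|Rm s i j m| ^+ 2)) * (x m)%:C.
Proof.
rewrite mxE; apply: eq_bigr => m _; rewrite !mxE; congr (_ * _).
apply: eq_bigr => j _; rewrite !mxE summxE; congr (_ * _).
by apply: eq_bigr => i _; rewrite !mxE.
Qed.

(** The noise term alone is positive, so zero entries are allowed; this covers allocations in which
    some user is switched off. *)
Lemma fd_gt0 x rho k :
  (forall m, 0 <= x m) -> (forall k, 0 <= rho k) -> 0 < fd s x rho k.
Proof.
move=> x_ge0 rho_ge0.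
have coef_ge0 i : 0 <= coef rho k i.
  by rewrite ge0C// divr_ge0 ?mulr_ge0// ltW ?mulr_gt0.
suff fdC_gt0 : 0 < fdC s x rho k by rewrite -ltcR RRe_real ?gtr0_real.
rewrite /fdC tr_noise quadE ltr_wpDl//; last first.
  rewrite ltr_wpDl ?mulr_gt0 ?ltcR ?tr_Amx_gt0// sumr_ge0// => i _.
  by rewrite mulr_ge0 ?ge0C// psdmx_trM_ge0//; exact: Amx_psd.
rewrite addr_ge0// sumr_ge0// => m _; rewrite mulr_ge0 ?ge0C//.
  apply: addr_ge0; first by apply: mulr_ge0; [rewrite ge0C|rewrite exprn_ge0].
  apply: sumr_ge0 => i _; apply: addr_ge0.
    by apply: mulr_ge0; [exact: coef_ge0|rewrite exprn_ge0].
  apply: mulr_ge0; last exact/psdmx_diag_ge0/Amx_psd.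
  by apply: mulr_ge0; [rewrite ge0C|exact: psdmx_diag_ge0].
rewrite sumr_ge0// => j _; rewrite mulr_ge0 ?ge0C// sumr_ge0// => i _.
by rewrite !mulr_ge0 ?exprn_ge0.
Qed.

Lemma fd_posynomial0 k :
  is_posynomial0 (fun u : gpvar M K -> R => fd s (xvar u) (rhovar u) k).
Proof.
have cst_posynomial (r : R[i]) :
    0 <= r -> is_posynomialC (fun _ : gpvar M K -> R => r).
  exact: is_posynomialC_cst.
have x_posynomial m :
    is_posynomialC (fun u : gpvar M K -> R => (xvar u m)%:C).
  exact: is_posynomialC_var.
have rho_posynomial i :
    is_posynomialC (fun u : gpvar M K -> R => (rhovar u i)%:C).
  exact: is_posynomialC_var.
have coef_posynomial i :
    is_posynomialC (fun u : gpvar M K -> R => coef (rhovar u) k i).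
  (* Reassociating separates the variable [rhovar u i] from its positive constant factor. *)
  rewrite /coef; under eq_fun do rewrite -mulrA rmorphM /=.
  apply: is_posynomialCM => //; apply: cst_posynomial.
  by rewrite ge0C// divr_ge0// ltW ?mulr_gt0.
apply: is_posynomialC_Re; rewrite /fdC.
under eq_fun do rewrite tr_noise quadE.
apply: is_posynomialCD; first apply: is_posynomialCD.
- apply: is_posynomialC_sum => m; apply: is_posynomialCM => //.
  apply: is_posynomialCD.
    by apply: is_posynomialCM => //; apply: cst_posynomial; rewrite exprn_ge0.
  apply: is_posynomialC_sum => i; apply: is_posynomialCD.
    apply: is_posynomialCM; first exact: coef_posynomial.
    by apply: cst_posynomial; rewrite exprn_ge0.
  under eq_fun do rewrite -mulrA.
  apply: is_posynomialCM => //; apply: cst_posynomial.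
  by rewrite mulr_ge0// psdmx_diag_ge0//; exact: Amx_psd.
- apply: is_posynomialC_sum => m; apply: is_posynomialCM => //.
  apply: is_posynomialC_sum => j; apply: is_posynomialCM => //.
  apply: is_posynomialC_sum => i; apply: is_posynomialCM => //.
  by apply: cst_posynomial; rewrite mulr_ge0 ?exprn_ge0.
- apply: is_posynomialCD.
    apply: is_posynomialC_sum => i; apply: is_posynomialCM => //.
    by apply: cst_posynomial; rewrite psdmx_trM_ge0//; exact: Amx_psd.
  by apply: cst_posynomial; rewrite mulr_ge0 ?ge0C ?ltW ?tr_Amx_gt0.
Qed.

End SINRasRatio.

(** * Transfer of optima, and the constraints shared by both programs *)

Section Equivalence.
Context {R : realType} {M K : nat}.
Implicit Types (eps x : 'I_M -> R) (rho : 'I_K -> R) (u : gpvar M K -> R).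

(** The two problems dominate each other: program points map to allocations at least as good, and
    allocations with positive powers lift with the same value. The third premise handles the
    allocations that do not lift, by strictly improving them. *)
Lemma equivalent_of_domination
    (P : maximization R (('I_M -> R) * ('I_K -> R)))
    (G : positive_program R (gpvar M K)) :
  (forall u, feasible (gp_maximization G) u ->
     feasible P (fun m => Num.sqrt (xvar u m), rhovar u) /\
     gp_objective G u <= objective P (fun m => Num.sqrt (xvar u m), rhovar u)) ->
  (forall eps rho, feasible P (eps, rho) -> positive rho -> exists t,
     feasible (gp_maximization G) (gppoint t (fun m => eps m ^+ 2) rho) /\
     gp_objective G (gppoint t (fun m => eps m ^+ 2) rho) =
       objective P (eps, rho)) ->
  (forall eps rho, feasible P (eps, rho) -> ~ positive rho -> exists rho',
     [/\ feasible P (eps, rho'), positive rho' &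
         objective P (eps, rho) < objective P (eps, rho')]) ->
  equivalent P G.
Proof.
move=> GP PG P0.
have dominated er : feasible P er -> exists2 u,
    feasible (gp_maximization G) u & objective P er <= gp_objective G u.
  case: er => eps rho erP; have [rho_gt0|/(P0 _ _ erP)] := pselect (positive rho).
    by have [t [? tE]] := PG _ _ erP rho_gt0; eexists; [eassumption|rewrite tE].
  move=> [rho' [er'P rho'_gt0 lt_er_er']].
  have [t [? tE]] := PG _ _ er'P rho'_gt0; eexists; first eassumption.
  by rewrite tE ltW.
split.
- apply/eqP; rewrite eq_le; apply/andP; split; apply: ge_ereal_sup.
    move=> _ [er /dominated[u uG le_er_u] <-].
    apply: le_ereal_sup_tmp; exists (gp_objective G u)%:E.
      by exists u.
    by rewrite lee_fin.
  move=> _ [u /GP[erP le_u_er] <-].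
  apply: le_ereal_sup_tmp; eexists; first by eexists; [exact: erP|reflexivity].
  by rewrite lee_fin.
(* An optimal allocation admits no strict improvement, so all its powers are positive and it
   lifts. *)
- move=> eps rho [erP er_max]; have rho_gt0 : positive rho.
    apply: contrapT => /(P0 _ _ erP)[rho' [/er_max + _]].
    by rewrite leNgt => /negP.
  have [t [uG uE]] := PG _ _ erP rho_gt0; exists t; split=> // u' /GP[/er_max le_er].
  by move=> /le_trans; apply; rewrite /= uE.
- move=> t x rho [uG u_max]; have [erP le_u_er] := GP _ uG; split=> //.
  move=> er' /dominated[u' /u_max/= le_u' /le_trans]; apply.
  exact: le_trans le_u' le_u_er.
Qed.

Lemma ln_prod (I : finType) (f : I -> R) : (forall i, 0 < f i) ->
  ln (\prod_i f i) = \sum_i ln (f i).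
Proof.
move=> f_gt0.
(* Positivity of the partial products is carried through the induction because [lnM] needs it. *)
suff [] : 0 < \prod_i f i /\ ln (\prod_i f i) = \sum_i ln (f i) by [].
apply: (big_ind2 (fun p q => 0 < p /\ ln p = q)); first by rewrite ln1.
  by move=> p _ q _ [p_gt0 <-] [q_gt0 <-]; rewrite mulr_gt0// lnM.
by move=> i _.
Qed.

Variable s : system R M K.
Hypothesis zeta_gt0 : forall m, 0 < zeta s m.

Lemma allocation_eps_gt0 eps rho m : allocation s (eps, rho) -> 0 < eps m.
Proof.
move=> [bits_le eps_bounds _]; have /andP[eps_ge0 _] := eps_bounds m.
rewrite lt_def eps_ge0 andbT; apply/eqP => eps0.
(* No term of the sum is [-oo], so a single infinite one makes the whole sum infinite. *)
have bits_y : (\sum_m bits s eps m = +oo)%E.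
  apply/eqP; rewrite esum_eqy => [|i _]; last by rewrite /bits; case: ifP.
  by apply/existsP; exists m; rewrite /bits eps0 !eqxx.
by move: bits_le; rewrite /= bits_y.
Qed.

Lemma bits_budget eps : (forall m, 0 < eps m) ->
  (\sum_m bits s eps m - (b_tot s)%:E <= 0)%E =
  (\prod_m (zeta s m ^+ 2 * (eps m ^+ 2)^-1) <= 2 `^ (2 * b_tot s)).
Proof.
move=> eps_gt0; have ln2_gt0 : 0 < ln (2 : R) by rewrite ln_gt0 ?ltr1n.
have ratio_gt0 m : 0 < zeta s m / eps m by rewrite divr_gt0.
have bitsE m : bits s eps m = (log2 (zeta s m / eps m))%:E.
  by rewrite /bits gt_eqF.
rewrite (eq_bigr _ (fun m _ => bitsE m)) sumEFin -EFinB lee_fin subr_le0.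
rewrite -ler_ln ?posrE ?powR_gt0 ?prodr_gt0// => [|m _]; last first.
  by rewrite mulr_gt0 ?invr_gt0 ?exprn_gt0.
rewrite ln_powR ln_prod => [|m]; last by rewrite mulr_gt0 ?invr_gt0 ?exprn_gt0.
(* Squaring the ratios produces the factor 2 that cancels the one in the exponent [2 * b_tot s];
   [ln 2] cancels likewise. *)
have -> : \sum_m ln (zeta s m ^+ 2 * (eps m ^+ 2)^-1) =
    2 * (\sum_m log2 (zeta s m / eps m) * ln 2).
  rewrite mulr_sumr; apply: eq_bigr => m _.
  by rewrite -expr_div_n lnXn// /log2 divfK ?gt_eqF// mulr_natl.
by rewrite -mulr_suml mulrA ler_pM2r// ler_pM2l.
Qed.

Lemma common_constraintsP u : 0 < eps_max s -> positive u ->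
  (forall gc, gc \in common_constraints s -> gc.1 u <= gc.2) <->
  allocation s (fun m => Num.sqrt (xvar u m), rhovar u).
Proof.
move=> eps_max_gt0 u_gt0.
have x_gt0 m : 0 < xvar u m by exact: u_gt0.
have sqrt_gt0 m : 0 < Num.sqrt (xvar u m) by rewrite sqrtr_gt0.
have budgetE : (\sum_m bits s (fun m => Num.sqrt (xvar u m)) m -
    (b_tot s)%:E <= 0)%E =
    (\prod_m (zeta s m ^+ 2 * (xvar u m)^-1) <= 2 `^ (2 * b_tot s)).
  rewrite bits_budget//; congr (_ <= _).
  by apply: eq_bigr => m _; rewrite sqr_sqrtr ?ltW.
have epsE m : (Num.sqrt (xvar u m) <= eps_max s) = (xvar u m <= eps_max s ^+ 2).
  by rewrite -[LHS](@ler_pXn2r _ 2) ?nnegrE ?sqrtr_ge0 ?(ltW eps_max_gt0)//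
    sqr_sqrtr ?(ltW (x_gt0 m)).
split=> [common|[budget eps_bounds rho_bounds] gc].
  split=> /=.
  - rewrite budgetE.
    exact: (common (_, _) (mem_head _ _)).
  - move=> m; rewrite sqrtr_ge0 epsE.
    apply: (common ((fun u => xvar u m), _)).
    by rewrite inE mem_cat map_f ?mem_enum ?orbT.
  - move=> k; rewrite (ltW (u_gt0 _))/=.
    apply: (common ((fun u => rhovar u k), _)).
    by rewrite inE mem_cat map_f ?mem_enum ?orbT.
rewrite inE mem_cat => /predU1P[->|/orP[]/mapP[j _ ->]] /=.
- by rewrite -budgetE.
- by have /andP[_] := eps_bounds j; rewrite epsE.
- by have /andP[] := rho_bounds j.
Qed.

Lemma common_constraints_posynomial gc :
  0 < eps_max s -> 0 < rho_max s ->
  gc \in common_constraints s -> is_posynomial gc.1 /\ 0 < gc.2.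
Proof.
move=> eps_max_gt0 rho_max_gt0.
rewrite inE mem_cat => /predU1P[->|/orP[]/mapP[j _ ->]] /=; split.
- apply/is_monomial_posynomial/is_monomial_prod => m.
  apply: is_monomialM; first by apply: is_monomial_cst; rewrite exprn_gt0.
  exact/is_monomialV/is_monomial_var.
- by rewrite powR_gt0.
- exact/is_monomial_posynomial/is_monomial_var.
- by rewrite exprn_gt0.
- exact/is_monomial_posynomial/is_monomial_var.
- by [].
Qed.

End Equivalence.

(** * The two geometric programs and their equivalence with the original problems *)

Section Programs.
Context {R : realType} {M K : nat}.
Variable s : system R M K.
Hypothesis Rm_psd : forall k, psdmx (Rm s k).
Hypothesis Rm_neq0 : forall k, Rm s k != 0.
Hypothesis Psi_pd : forall k, pdmx (Psi s k).
Hypothesis tau_p_gt0 : 0 < tau_p s.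
Hypothesis varrho_gt0 : forall k, 0 < varrho s k.
Hypothesis sigma2_gt0 : 0 < sigma2 s.
Hypothesis zeta_gt0 : forall m, 0 < zeta s m.
Hypothesis eps_max_gt0 : 0 < eps_max s.
Hypothesis rho_max_gt0 : 0 < rho_max s.
Implicit Types (eps x : 'I_M -> R) (rho v : 'I_K -> R) (u : gpvar M K -> R).

Let w_gt0 := w_gt0 Rm_psd Psi_pd Rm_neq0.

Let fd_gt0 x rho k :
  (forall m, 0 <= x m) -> (forall k, 0 <= rho k) -> 0 < fd s x rho k.
Proof. exact: fd_gt0. Qed.

Let fd_var_gt0 u k : positive u -> 0 < fd s (xvar u) (rhovar u) k.
Proof. by move=> u_gt0; apply: fd_gt0 => ?; exact/ltW/u_gt0. Qed.

Let sinr_sqrt u k : positive u ->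
  sinr s (fun m => Num.sqrt (xvar u m)) (rhovar u) k =
  rhovar u k * w s k / fd s (xvar u) (rhovar u) k.
Proof.
move=> u_gt0; rewrite sinrE//; congr (_ / fd _ _ _ _).
by apply/funext => m; rewrite sqr_sqrtr// ltW//; exact: u_gt0.
Qed.

(* Requiring [value] to be positive at positive vectors and nonpositive at
   nonnegative ones with a zero entry makes it suboptimal to switch off a
   user. *)
Lemma equivalent_sinr_program (value : ('I_K -> R) -> R)
    (G : positive_program R (gpvar M K))
    (t_feasible : (gpvar M K -> R) -> Prop) :
  (forall v, (forall k, 0 < v k) -> 0 < value v) ->
  (forall v k, v k = 0 -> (forall k, 0 <= v k) -> value v <= 0) ->
  (forall u, feasible (gp_maximization G) u <->
    [/\ positive u, t_feasible u &
        forall gc, gc \in common_constraints s -> gc.1 u <= gc.2]) ->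
  (forall u, positive u -> t_feasible u -> gp_objective G u <=
    value (fun k => rhovar u k * w s k / fd s (xvar u) (rhovar u) k)) ->
  (forall x rho, (forall m, 0 < x m) -> (forall k, 0 < rho k) ->
    exists t, [/\ 0 < t, t_feasible (gppoint t x rho) &
      gp_objective G (gppoint t x rho) =
        value (fun k => rho k * w s k / fd s x rho k)]) ->
  equivalent
    (Maximization (fun er => value (sinr s er.1 er.2)) (allocation s)) G.
Proof.
move=> value_gt0 value_le0 GE G_le G_ge; apply: equivalent_of_domination.
- move=> u /GE[u_gt0 ut ucommon]; split; first exact/common_constraintsP.
  rewrite /= (_ : sinr s _ _ =
    fun k => rhovar u k * w s k / fd s (xvar u) (rhovar u) k); first exact: G_le.
  by apply/funext => k; exact: sinr_sqrt.
- move=> eps rho erP rho_gt0.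
  have eps_gt0 m := allocation_eps_gt0 m erP.
  have x_gt0 m : 0 < eps m ^+ 2 by exact: exprn_gt0.
  have [t [t_gt0 ut tE]] := G_ge _ _ x_gt0 rho_gt0; exists t; split.
    have u_gt0 : positive (gppoint t (fun m => eps m ^+ 2) rho).
      by move=> [[[]|m]|k] /=.
    apply/GE; split=> //; apply/common_constraintsP => //.
    suff -> : (fun m => Num.sqrt (eps m ^+ 2)) = eps by [].
    by apply/funext => m; rewrite sqrtr_sqr gtr0_norm.
  by rewrite tE /=; congr value; apply/funext => k; rewrite sinrE.
- move=> eps rho erP; have eps_gt0 m := allocation_eps_gt0 m erP.
  have [bits_le eps_bounds rho_bounds] := erP.
  (* All users get full power while [eps] is kept, so the bit budget still holds. *)
  move=> /existsNP[k /negP rhok_le0]; exists (fun=> rho_max s); split=> //.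
    by split=> // j; rewrite (ltW rho_max_gt0) lexx.
  have x_ge0 m : 0 <= eps m ^+ 2 by exact: sqr_ge0.
  have rho_ge0 j : 0 <= rho j by have /andP[] := rho_bounds j.
  have rhok0 : rho k = 0 by apply/eqP; rewrite eq_le rho_ge0 leNgt rhok_le0.
  apply: (@le_lt_trans _ _ 0) => /=.
    apply: (value_le0 _ k) => [|j]; first by rewrite sinrE// rhok0 !mul0r.
    by rewrite sinrE// divr_ge0 ?mulr_ge0 ?(ltW (w_gt0 _))
      ?(ltW (fd_gt0 _ _ _)).
  apply: value_gt0 => j; rewrite sinrE// divr_gt0 ?mulr_gt0//.
  by apply: fd_gt0 => // i; exact: ltW.
Qed.

Lemma max_product_is_gp : is_geometric_program (max_product_gp s).
Proof.
split=> [|gc].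
  apply: is_monomialM; first exact: is_monomial_var.
  apply: is_monomial_prod => k; apply: is_monomialM; first exact: is_monomial_var.
  exact: is_monomial_cst.
rewrite inE => /predU1P[->|]; last exact: common_constraints_posynomial.
split; last exact: ltr01.
apply: is_posynomial0_posynomial => [|/=].
  apply: is_posynomial0M; first exact/is_monomial_posynomial0/is_monomial_var.
  by apply: is_posynomial0_prod => k; exact: fd_posynomial0.
(* Positivity at the all-ones point excludes the empty sum of monomials. *)
by rewrite mulr_gt0 ?prodr_gt0 // => k _; apply: fd_gt0 => *; exact: ler01.
Qed.

Lemma max_product_equivalent : equivalent (max_product s) (max_product_gp s).
Proof.
apply: (@equivalent_sinr_program (fun v => \prod_k v k) _
  (fun u => tvar u * \prod_k fd s (xvar u) (rhovar u) k <= 1)).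
- by move=> v v_gt0; rewrite prodr_gt0.
- by move=> v k vk0 _; rewrite (bigD1 k)//= vk0 mul0r.
- move=> u; split=> [[u_gt0 constraints]|[u_gt0 ut ucommon]].
    split=> // [|gc gc_common]; first exact: (constraints (_, _) (mem_head _ _)).
    by apply: constraints; rewrite inE gc_common orbT.
  by split=> // gc; rewrite inE => /predU1P[->//|/ucommon].
- move=> u u_gt0 ut; have fd_prod_gt0 : 0 < \prod_k fd s (xvar u) (rhovar u) k.
    by rewrite prodr_gt0// => k _; exact: fd_var_gt0.
  rewrite prodf_div ler_pdivlMr//= mulrAC ler_piMl// prodr_ge0// => k _.
  by rewrite mulr_ge0 ?ltW//; exact: u_gt0.
- move=> x rho x_gt0 rho_gt0.
  have fd_prod_gt0 : 0 < \prod_k fd s x rho k.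
    by rewrite prodr_gt0// => k _; apply: fd_gt0 => ?; rewrite ltW.
  (* This [t] makes the product constraint an equality. *)
  exists (\prod_k fd s x rho k)^-1; split; first by rewrite invr_gt0.
    by rewrite /= /tvar /= mulVf ?gt_eqF.
  by rewrite prodf_div mulrC.
Qed.

Lemma max_min_is_gp : is_geometric_program (max_min_gp s).
Proof.
split=> [|gc]; first exact: is_monomial_var.
rewrite mem_cat => /orP[/mapP[k _ ->]|]; last exact: common_constraints_posynomial.
split; last exact: ltr01.
apply: is_posynomial0_posynomial => [|/=].
  apply: is_posynomial0M.
    apply: is_posynomial0M; last exact: fd_posynomial0.
    exact/is_monomial_posynomial0/is_monomial_var.
  apply/is_monomial_posynomial0/is_monomialV/is_monomialM.
    exact: is_monomial_var.
  exact: is_monomial_cst.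
by rewrite divr_gt0 ?mulr_gt0//; apply: fd_gt0 => *; exact: ler01.
Qed.

Lemma max_min_equivalent (K_gt0 : (0 < K)%N) :
  equivalent (max_min s K_gt0) (max_min_gp s).
Proof.
(* Each constraint says that [t] is at most the SINR of user [k]; jointly they bound [t] by the
   minimum. *)
have constraintE u k : positive u ->
    (tvar u * fd s (xvar u) (rhovar u) k / (rhovar u k * w s k) <= 1) =
    (tvar u <= rhovar u k * w s k / fd s (xvar u) (rhovar u) k).
  move=> u_gt0; rewrite ler_pdivrMr ?mul1r ?mulr_gt0//; last exact: u_gt0.
  by rewrite ler_pdivlMr// fd_var_gt0.
apply: (@equivalent_sinr_program (min_ord K_gt0) _
  (fun u => forall k,
     tvar u <= rhovar u k * w s k / fd s (xvar u) (rhovar u) k)).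
- by move=> v v_gt0; rewrite /min_ord lt_bigmin.
- by move=> v k vk0 _; rewrite -vk0; exact: bigmin_le.
- move=> u; split=> [[u_gt0 constraints]|[u_gt0 ut ucommon]].
    split=> // [k|gc gc_common]; last first.
      by apply: constraints; rewrite mem_cat gc_common orbT.
    rewrite -constraintE//.
    apply: (constraints ((fun u => tvar u * fd s (xvar u) (rhovar u) k /
      (rhovar u k * w s k)), _)).
    by rewrite mem_cat map_f ?mem_enum.
  split=> // gc; rewrite mem_cat => /orP[/mapP[k _ ->]|/ucommon//].
  by rewrite /= constraintE.
- by move=> u u_gt0 ut; rewrite /min_ord le_bigmin.
- move=> x rho x_gt0 rho_gt0.
  (* The largest feasible [t] is the smallest SINR; it is positive because each ratio is, including
     the default value of the iterated minimum. *)
  exists (min_ord K_gt0 (fun k => rho k * w s k / fd s x rho k)); split=> //.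
    have sinr_gt0 k : 0 < rho k * w s k / fd s x rho k.
      by rewrite divr_gt0 ?mulr_gt0//; apply: fd_gt0 => ?; rewrite ltW.
    by rewrite /min_ord lt_bigmin.
  by move=> k; exact: bigmin_le.
Qed.

End Programs.

Theorem theorem3 (R : realType) (M K : nat) (s : system R M K)
    (K_gt0 : (0 < K)%N)
    (Rm_psd : forall k, psdmx (Rm s k))
    (Rm_neq0 : forall k, Rm s k != 0)
    (Psi_pd : forall k, pdmx (Psi s k))
    (tau_p_gt0 : 0 < tau_p s)
    (varrho_gt0 : forall k, 0 < varrho s k)
    (sigma2_gt0 : 0 < sigma2 s)
    (zeta_gt0 : forall m, 0 < zeta s m)
    (b_tot_gt0 : 0 < b_tot s)
    (eps_max_gt0 : 0 < eps_max s)
    (rho_max_gt0 : 0 < rho_max s) :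
  (is_geometric_program (max_product_gp s) /\
   equivalent (max_product s) (max_product_gp s)) /\
  (is_geometric_program (max_min_gp s) /\
   equivalent (max_min s K_gt0) (max_min_gp s)).
Proof.
split; split.
- exact: max_product_is_gp.
- exact: max_product_equivalent.
- exact: max_min_is_gp.
- exact: max_min_equivalent.
Qed.
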